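(* Let $(X,T)$ be a Polish dynamical system with the strong approximate product structure. If a bounded continuous function $\varphi\colon X\to\mathbb{R}$ and $\alpha\in\mathbb{R}$ are such that \[ V_\varphi(\alpha)=\Big\{\mu\in\mathcal{M}_T(X): \int\varphi\,d\mu=\alpha\Big\}\neq\emptyset \] and $U=\mathcal{M}_T(X)\setminus V_\varphi(\alpha)\ne\emptyset$, then $B_\varphi(\alpha)$ is a $\boldsymbol{\Pi}^0_3$-complete set and $I_\varphi(X,T)$ is a $\boldsymbol{\Sigma}^0_3$-complete set.
   Context: A Polish dynamical system $(X,T)$ is a Polish space $X$ with a fixed compatible complete metric $\rho$ and a continuous map $T\colon X\to X$ ($X$ not assumed compact). $\mathcal{M}_T(X)$ is the set of $T$-invariant Borel probability measures on $X$. For bounded continuous $\varphi\colon X\to\mathbb{R}$ and $k\ge 1$, $A_k\varphi(x)=\frac1k\sum_{j=0}^{k-1}\varphi(T^j(x))$. $B_\varphi(\alpha)=\{x\in X:\lim_{k\to\infty}A_k\varphi(x)=\alpha\}$. $I_\varphi(X,T)$ is the set of $x\in X$ for which $(A_k\varphi(x))_{k\ge 1}$ does not converge. Strong approximate product structure: a specification is a finite sequence $\xi=(\langle x_j,n_j\rangle)_{j=1}^k$ with $x_j\in X$, $n_j\ge1$, $k\ge 1$. For finite $\Lambda\subseteq\{0,1,2,\dots\}$, $B_\Lambda(x,\varepsilon)=\{y:\rho(T^j x,T^j y)<\varepsilon\ \forall j\in\Lambda\}$, and $B_n=B_{\{0,\dots,n-1\}}$. A point $y$ $(\varepsilon,\delta_1,\delta_2)$-approximately-traces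 $\xi$ if $y\in B_{n_1}(x_1,\varepsilon)$ and for each $2\le j\le k$ there are $\Lambda_j\subseteq\{0,\dots,n_j-1\}$ with $|\Lambda_j|\ge(1-\delta_1)n_j$ and an integer $0\le s_{j-1}\le\delta_2 n_j$ such that $T^{\sum_{i=1}^{j-1}(s_i+n_i)}(y)\in B_{\Lambda_j}(x_j,\varepsilon)$. $(X,T)$ has the strong approximate product structure if for all $\varepsilon,\delta_1,\delta_2>0$ there is a nonnegative integer $N$ such that for every specification with all $n_j\ge N$ there is a point $y\in X$ that $(\varepsilon,\delta_1,\delta_2)$-approximately-traces it. Borel hierarchy: $\boldsymbol{\Sigma}^0_1$ = open sets, $\boldsymbol{\Pi}^0_n$ = complements of $\boldsymbol{\Sigma}^0_n$ sets, $\boldsymbol{\Sigma}^0_{n+1}$ = countable unions of $\boldsymbol{\Pi}^0_n$ sets. $A$ is $\boldsymbol{\Pi}^0_3$-complete if $A\in\boldsymbol{\Pi}^0_3\setminus\boldsymbol{\Sigma}^0_3$, and $\boldsymbol{\Sigma}^0_3$-complete if $A\in\boldsymbol{\Sigma}^0_3\setminus\boldsymbol{\Pi}^0_3$. *)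

(* Defs.v *)
From HB Require Import structures.
From mathcomp Require Import all_boot all_order all_algebra.
From mathcomp Require Import all_classical all_reals all_analysis.

Set Implicit Arguments.
Unset Strict Implicit.
Unset Printing Implicit Defensive.

Import Order.TTheory GRing.Theory Num.Theory.
Import numFieldNormedType.Exports.

Local Open Scope classical_set_scope.
Local Open Scope ring_scope.

(* The library's [Complete] extends [Pointed], so these spaces are nonempty;
   this loses nothing wherever a probability measure on the space exists. *)
#[short(type="completeMetricType")]
HB.structure Definition CompleteMetric (R : numDomainType) :=
  {X of CompletePseudoMetric R X & PseudoMetric_isMetric R X}.

Definition separable (X : topologicalType) :=
  exists2 D : set X, countable D & dense D.

Notation borelType X := (g_sigma_algebraType (@open X)).

Section borel_hierarchy.
Context {X : topologicalType}.

(* The hierarchy starts at level 1; level 0 is junk. *)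
Fixpoint Sigma0 (n : nat) : set (set X) :=
  match n with
  | 0 => set0
  | m.+1 => if m is 0 then open else
      [set A | exists2 F : nat -> set X,
         (forall i, Sigma0 m (~` F i)) & A = \bigcup_i F i]
  end.

Definition Pi0 (n : nat) : set (set X) := [set A | Sigma0 n (~` A)].

Definition Pi0_3_complete (A : set X) := Pi0 3 A /\ ~ Sigma0 3 A.

Definition Sigma0_3_complete (A : set X) := Sigma0 3 A /\ ~ Pi0 3 A.

End borel_hierarchy.

Section approximate_product_structure.
Context {R : realType} {X : completeMetricType R} (T : X -> X).

Definition bowen_ball (n : nat) (L : {set 'I_n}) (x : X) (e : R) : set X :=
  [set y | forall j : 'I_n, j \in L -> mdist (iter j T x) (iter j T y) < e].

Definition specification (xi : seq (X * nat)) : Prop :=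
  (0 < size xi)%N /\ forall p, p \in xi -> (1 <= p.2)%N.

(* Indices are shifted down by one: [x 0], ..., [x k.-1] are the points of the
   specification, and the gap [s j] separates its pieces [j] and [j.+1]. *)
Definition approx_traces (e d1 d2 : R) (xi : seq (X * nat)) (y : X) : Prop :=
  let x j := (nth (point, 0%N) xi j).1 in
  let n j := (nth (point, 0%N) xi j).2 in
  bowen_ball [set: 'I_(n 0%N)] (x 0%N) e y /\
  exists s : nat -> nat, forall j, (j.+1 < size xi)%N ->
    (s j)%:R <= d2 * (n j.+1)%:R /\
    exists2 L : {set 'I_(n j.+1)},
      (1 - d1) * (n j.+1)%:R <= #|L|%:R &
      bowen_ball L (x j.+1) e (iter (\sum_(i < j.+1) (s i + n i)) T y).

Definition strong_approx_product_structure : Prop :=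
  forall e d1 d2 : R, 0 < e -> 0 < d1 -> 0 < d2 ->
    exists N : nat, forall xi : seq (X * nat), specification xi ->
      (forall p, p \in xi -> (N <= p.2)%N) ->
      exists y : X, approx_traces e d1 d2 xi y.

End approximate_product_structure.

Section birkhoff.
Context {R : realType} {X : completeMetricType R} (T : X -> X).

Definition birkhoff_avg (phi : X -> R) (k : nat) (x : X) : R :=
  k%:R^-1 * \sum_(j < k) phi (iter j T x).

Definition level_set (phi : X -> R) (alpha : R) : set X :=
  [set x | birkhoff_avg phi k x @[k --> \oo] --> alpha].

Definition irregular_set (phi : X -> R) : set X :=
  [set x | ~ cvg (birkhoff_avg phi k x @[k --> \oo])].

Definition invariant_measures : set (probability (borelType X) R) :=
  [set mu : probability (borelType X) R |
    forall A : set (borelType X), measurable A -> mu (T @^-1` A) = mu A].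

Definition measures_with_integral (phi : X -> R) (alpha : R) :
    set (probability (borelType X) R) :=
  [set mu : probability (borelType X) R |
    invariant_measures mu /\ (\int[mu]_x (phi x)%:E)%E = alpha%:E].

End birkhoff.

(* Main.v *)
Require Import Defs.
From HB Require Import structures.
From mathcomp Require Import all_boot all_order all_algebra.
From mathcomp Require Import all_classical all_reals all_analysis.
From mathcomp Require Import measurable_realfun zify ring lra.
Set Implicit Arguments.
Unset Strict Implicit.
Unset Printing Implicit Defensive.

Import Order.TTheory GRing.Theory Num.Theory.
Import numFieldNormedType.Exports.
Local Open Scope classical_set_scope.
Local Open Scope ring_scope.

(** The set of sequences of naturals tending to infinity is not Sigma^0_3 (a
    Baire category argument), so it suffices to find a continuous
    [f : (nat -> nat) -> X] such that the Birkhoff averages along the orbit of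
    [f a] tend to [alpha] when [a] tends to infinity, and diverge otherwise.
    The orbit of [f a] is steered through stages whose target averages are
    alternately [alpha + (beta - alpha) / (a k + 1)] and [alpha], where [beta]
    is the integral of [phi] for another invariant measure.

    No ergodic theorem is needed: integrating an orbit sum against an invariant
    measure yields, for every length [m], orbit segments of average at most
    [lo + tau] and at least [hi - tau], where [lo < hi] are the two integrals,
    and a greedy concatenation of such blocks has any prescribed average
    between them.  As [phi] is not uniformly continuous, the segments are also
    chosen to avoid most of the time the points near which [phi] oscillates,
    so that every point shadowing them has almost the same averages.  The
    shadowing scale of each stage is fixed in advance, independently of the
    points constructed, so a stage can be prolonged until its length dominates
    the constants of the next one. *)

(** * Baire category for the sequences of naturals that tend to infinity *)

Definition agree (k : nat) (a b : nat -> nat) : Prop :=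
  forall i, (i < k)%N -> b i = a i.

Definition diverges (a : nat -> nat) : Prop :=
  forall M, exists K, forall k, (K <= k)%N -> (M <= a k)%N.

Lemma prefix_limit (c : nat -> nat -> nat) (l : nat -> nat) :
  (forall j, (l j < l j.+1)%N) -> (forall j, agree (l j) (c j) (c j.+1)) ->
  exists d, forall j, agree (l j) (c j) d.
Proof.
move=> l_incr c_ext.
have l_mono : {homo l : i j / (i <= j)%N}.
  by apply: homo_leq => //; [exact: leq_trans | move=> j; exact/ltnW].
have l_ge j : (j <= l j)%N by elim: j => // j /leq_ltn_trans; apply.
have c_agree i j : (i <= j)%N -> agree (l i) (c i) (c j).
  elim: j => [|j IHj]; first by rewrite leqn0 => /eqP ->.
  rewrite leq_eqVlt => /predU1P[-> //|]; rewrite ltnS => le_ij k lt_k.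
  by rewrite c_ext ?IHj// (leq_trans lt_k)// l_mono.
(* Since [l] increases strictly, [l i.+1] exceeds [i], so entry [i] is already frozen in
   [c i.+1]. *)
exists (fun i => c i.+1 i) => j i lt_i.
have [le_ji|lt_ij] := leqP j i.+1; first exact: c_agree.
by rewrite (c_agree i.+1 j (ltnW lt_ij))// (leq_trans _ (l_ge _)).
Qed.

(** The pair [s] encodes a finite word, the first [s.2] entries of [s.1]; the later entries of [s.1]
    carry no information. *)
Definition tail_cylinder (n : nat) (s : (nat -> nat) * nat) (b : nat -> nat) :=
  agree s.2 s.1 b /\ forall i, (s.2 <= i)%N -> (n <= b i)%N.

(* Baire category: if [O] were dense in the closed set [tail_cylinder n s], then
   its intersection with the dense G_delta set of sequences taking the value
   [n] infinitely often would be nonempty. *)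
Lemma Gdelta_diverges_not_dense (O : nat -> set (nat -> nat)) :
    (forall m a, O m a -> exists k, forall b, agree k a b -> O m b) ->
    (forall a, (forall m, O m a) -> diverges a) ->
  forall n s, exists s' : (nat -> nat) * nat,
    [/\ (s.2 < s'.2)%N, tail_cylinder n s s'.1 &
     forall b, tail_cylinder n s b -> agree s'.2 s'.1 b ->
       ~ forall m, O m b].
Proof.
move=> O_open O_div n s; apply: contrapT => no_s'.
have dense_O (c : nat -> nat) l : tail_cylinder n s c -> (s.2 < l)%N ->
    exists2 b, tail_cylinder n s b & agree l c b /\ forall m, O m b.
  move=> cZ lt_l; apply: contrapT => no_b; apply: no_s'.
  by exists (c, l); split=> // b bZ cb Ob; apply: no_b; exists b.
have step (p : nat * ((nat -> nat) * nat)) :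
    exists q : (nat -> nat) * nat,
    tail_cylinder n s p.2.1 -> (s.2 <= p.2.2)%N ->
    [/\ tail_cylinder n s q.1, (p.2.2 < q.2)%N, agree p.2.2 p.2.1 q.1,
        q.1 p.2.2 = n & forall b, agree q.2 q.1 b -> O p.1 b].
  case: p => m [c l] /=.
  have [[cZ le_l]|nP] := pselect (tail_cylinder n s c /\ (s.2 <= l)%N); last first.
    by exists (c, l) => cZ le_l; case: nP.
  (* Writing [n] at position [l] stays inside the closed set. Repeated at positions that go to
     infinity, this gives a limit that takes the value [n] infinitely often and so does not
     diverge. *)
  pose c1 i := if i == l then n else c i.
  have c1Z : tail_cylinder n s c1.
    split=> i; rewrite /c1; last by case: eqP => // _ le_i; exact: cZ.2.
    by case: eqP => [->|_ lt_i]; [rewrite ltnNge le_l | exact: cZ.1].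
  have [b bZ [c1b Ob]] := dense_O c1 l.+1 c1Z le_l.
  have [k Ok] := O_open m b (Ob m).
  exists (b, maxn k l.+1) => _ _; split=> //=.
  - by rewrite leq_maxr.
  - by move=> i lt_i; rewrite c1b ?(leq_trans lt_i)// /c1 ltn_eqF.
  - by rewrite c1b// /c1 eqxx.
  - by move=> e be; apply: Ok => i lt_i; apply: be; rewrite leq_max lt_i.
have [next nextP] := choice step.
have [c0 c0Z] : exists c0, tail_cylinder n s c0.
  exists (fun i => if (i < s.2)%N then s.1 i else n); split=> i /=; first by move=> ->.
  by rewrite leqNgt => /negbTE ->.
pose st := fix st m := if m is m'.+1 then next (m', st m') else (c0, s.2).
have stP m : tail_cylinder n s (st m).1 /\ (s.2 <= (st m).2)%N.
  elim: m => [|m [stZ le_st]] //=.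
  have [? lt_st _ _ _] := nextP (m, st m) stZ le_st.
  by split=> //; rewrite (leq_trans le_st)// ltnW.
have stS m := nextP (m, st m) (stP m).1 (stP m).2.
have [d dP] : exists d, forall j, agree (st j).2 (st j).1 d.
  by apply: (@prefix_limit (fun j => (st j).1) (fun j => (st j).2)) => j;
    case: (stS j).
have : diverges d.
  by apply: O_div => m; have [_ _ _ _] := stS m; apply; exact: (dP m.+1).
move=> /(_ n.+1)[K dK].
have st_ge j : (j <= (st j).2)%N.
  by elim: j => // j /leq_ltn_trans; apply; case: (stS j).
have [_ lt_st _ st_n _] := stS K.
by have := dK _ (st_ge K); rewrite (dP K.+1) //= st_n ltnn.
Qed.

Lemma Sigma0_3P {X : topologicalType} (A : set X) : Sigma0 3 A ->
  exists2 O : nat -> nat -> set X, (forall i j, open (O i j)) &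
    A = \bigcup_i \bigcap_j O i j.
Proof.
move=> [F F2 ->].
have /choice[G GP] : forall i, exists G : nat -> set X,
    (forall j, open (~` G j)) /\ ~` F i = \bigcup_j G j.
  by move=> i; have [G G1 FG] := F2 i; exists G.
exists (fun i j => ~` G i j) => [i j|]; first by have [] := GP i.
by apply: eq_bigcup => // i _; rewrite -setC_bigcup -(GP i).2 setCK.
Qed.

(** Otherwise the diverging sequences would be a countable union of G_delta sets. Step [n] extends
    the current word so as to leave the [n]-th of them, and from then on admits only entries at
    least [n]; the limit diverges, yet lies in none of these sets. *)
Lemma Sigma0_3_reduction {X : topologicalType} (f : (nat -> nat) -> X) (A : set X) :
    (forall a (O : set X), open O -> O (f a) ->
       exists k, forall b, agree k a b -> O (f b)) ->
    Sigma0 3 A ->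
  ~ forall a, A (f a) <-> diverges a.
Proof.
move=> f_cont /Sigma0_3P[ O O_open ->{A}] fP.
pose O' i j a := O i j (f a).
have step (p : nat * ((nat -> nat) * nat)) : exists s' : (nat -> nat) * nat,
    [/\ (p.2.2 < s'.2)%N, tail_cylinder p.1 p.2 s'.1 &
     forall b, tail_cylinder p.1 p.2 b -> agree s'.2 s'.1 b ->
       ~ forall m, O' p.1 m b].
  case: p => n s /=; apply: Gdelta_diverges_not_dense => [m a|a Oa].
    exact: f_cont.
  by apply/fP; exists n => // m _; exact: Oa.
have [next nextP] := choice step.
pose st := fix st m := if m is m'.+1 then next (m', st m') else ((fun=> 0%N), 0%N).
have stS m := nextP (m, st m) : [/\ _, tail_cylinder m (st m) (st m.+1).1 & _].
have [d dP] : exists d, forall j, agree (st j).2 (st j).1 d.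
  apply: (@prefix_limit (fun j => (st j).1) (fun j => (st j).2)) => j;
    first by case: (stS j).
  by have [_ [ag _] _] := stS j.
have st_ge j : (j <= (st j).2)%N.
  by elim: j => // j /leq_ltn_trans; apply; case: (stS j).
(* An entry at position [i] is either frozen by an earlier word, which induction covers, or bounded
   below by the index of the last step taken. *)
have tail n j i : (n < j)%N -> ((st n).2 <= i)%N -> (n <= (st j).1 i)%N.
  elim: j => // j IHj; rewrite ltnS leq_eqVlt => /predU1P[->|lt_nj] le_i.
    by have [_ [_ +] _] := stS j; apply.
  have [_ [ag ge] _] := stS j.
  have [le_ji|lt_ij] := leqP (st j).2 i; first by rewrite (leq_trans (ltnW lt_nj))// ge.
  by rewrite ag// IHj.
have dZ n : tail_cylinder n (st n) d.
  split=> [|i le_i]; first exact: dP.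
  rewrite (dP (maxn n i).+1) ?tail ?ltnS ?leq_maxl//.
  by rewrite (leq_trans _ (st_ge _))// ltnS leq_maxr.
have : diverges d by move=> n; exists (st n).2; exact: (dZ n).2.
move=> /fP[n _ On]; have [_ _] := stS n.
by apply; [exact: dZ | exact: (dP n.+1) | move=> m; exact: On].
Qed.

(** * Upper bounds on the Borel classes *)

Lemma Pi0_3_bigcap_bigcup {X : topologicalType} (F : nat -> nat -> set X) :
  (forall m K, closed (F m K)) -> Pi0 3 (\bigcap_m \bigcup_K F m K).
Proof.
move=> F_closed; exists (fun m => ~` \bigcup_K F m K) => [m|].
  by exists (F m) => [K|]; [exact: closed_openC | rewrite setCK].
by rewrite setC_bigcap.
Qed.

Lemma iter_continuous {X : topologicalType} (T : X -> X) (j : nat) :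
  continuous T -> continuous (iter j T).
Proof.
move=> cT; elim: j => [|j IHj] x /=; first exact: cvg_id.
by apply: (@continuous_comp _ _ _ (iter j T) T); [exact: IHj | exact: cT].
Qed.

Section birkhoff_averages.
Context {R : realType} {X : completeMetricType R} (T : X -> X) (phi : X -> R).
Hypotheses (cT : continuous T) (cphi : continuous phi).

Lemma birkhoff_avg_continuous (k : nat) : continuous (birkhoff_avg T phi k).
Proof.
move=> x; rewrite /birkhoff_avg; apply: cvgM; first exact: cvg_cst.
apply: (cvg_big add_continuous) => i _.
apply: (@continuous_comp _ _ _ (iter i T) phi); last exact: cphi.
exact: iter_continuous.
Qed.

Lemma closed_norm_le (h : X -> R) (c : R) :
  continuous h -> closed [set x | `|h x| <= c].
Proof.
move=> ch; have cnh : continuous (fun x => `|h x|).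
  by move=> x; apply: cvg_norm; exact: ch.
apply: (proj1 (continuous_closedP _) cnh [set y | y <= c]); exact: closed_le.
Qed.

Lemma exists_natSinv_lt (e : R) : 0 < e -> exists m : nat, m.+1%:R^-1 < e.
Proof.
move=> e0; have [m _ /(_ m (leqnn m)) /= ?] := near_infty_natSinv_lt (PosNum e0).
by exists m.
Qed.

(** Convergence is unfolded with non-strict inequalities, so that the condition for fixed [m] and
    [K] is closed. *)
Lemma Pi0_3_level_set (alpha : R) : Pi0 3 (level_set T phi alpha).
Proof.
pose F m K := \bigcap_(k in [set k | (K <= k)%N])
  [set x | `|alpha - birkhoff_avg T phi k x| <= m.+1%:R^-1].
rewrite (_ : level_set T phi alpha = \bigcap_m \bigcup_K F m K).
  apply: Pi0_3_bigcap_bigcup => m K; apply: closed_bigI => k _.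
  apply: closed_norm_le => x; apply: cvgB; first exact: cvg_cst.
  exact: birkhoff_avg_continuous.
apply/seteqP; split=> x /=.
  move=> /cvgrPdist_le cx m _.
  have [|K _ KP] := cx m.+1%:R^-1; first by rewrite invr_gt0.
  by exists K => // k /= le_Kk; exact: KP.
move=> Fx; apply/cvgrPdist_le => e /exists_natSinv_lt[m me].
have [K _ KP] := Fx m I.
by exists K => // k /= le_Kk; rewrite (le_trans _ (ltW me))// KP.
Qed.

(** The Cauchy criterion expresses convergence without naming the limit, which avoids an uncountable
    union over all possible limits. *)
Lemma Sigma0_3_irregular_set : Sigma0 3 (irregular_set T phi).
Proof.
pose F m K := \bigcap_(k in [set k | (K <= k)%N]) \bigcap_(l in [set l | (K <= l)%N])
  [set x | `|birkhoff_avg T phi k x - birkhoff_avg T phi l x| <= m.+1%:R^-1].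
rewrite (_ : irregular_set T phi = ~` \bigcap_m \bigcup_K F m K).
  apply: Pi0_3_bigcap_bigcup => m K; apply: closed_bigI => k _.
  apply: closed_bigI => l _.
  by apply: closed_norm_le => x; apply: cvgB; exact: birkhoff_avg_continuous.
congr (~` _); apply/seteqP; split=> x /=.
  move=> /cvgrPdist_le cx m _.
  have [|K _ KP] := cx (2^-1 * m.+1%:R^-1); first by rewrite mulr_gt0// invr_gt0.
  exists K => // k /= le_Kk l /= le_Kl.
  have := KP k le_Kk; have := KP l le_Kl; rewrite /=.
  set L := lim _; set c := m.+1%:R^-1.
  rewrite distrC => kL lL.
  rewrite -(subrKA L) (le_trans (ler_normD _ _))//.
  rewrite distrC; rewrite distrC in kL; lra.
move=> Fx; apply/cauchy_cvgP/cauchy_exP => e /exists_natSinv_lt[m me].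
have [K _ KP] := Fx m I; exists (birkhoff_avg T phi K x).
exists K => // k /= le_Kk; rewrite /ball/= (le_lt_trans _ me)//.
exact: (KP K (leqnn K)).
Qed.

End birkhoff_averages.

(* Greedy choice: always append the value that pulls the partial sum back
   towards zero. *)
Lemma steering {R : realType} (u : bool -> R) (t K s : R) :
    0 <= s -> u true <= t + s -> t - s <= u false ->
    (forall b, `|u b - t| <= K) ->
  exists c : nat -> bool, forall p,
    `|\sum_(i < p) (u (c i) - t)| <= K + p%:R * s.
Proof.
move=> s0 ult ugt uK.
pose D := fix D p : R := if p is p'.+1 then D p' + (u (0 <= D p') - t) else 0.
exists (fun i => 0 <= D i) => p.
have -> : \sum_(i < p) (u (0 <= D i) - t) = D p.
  by elim: p => [|p IHp]; rewrite ?big_ord0// big_ord_recr/= IHp.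
have K0 : 0 <= K by rewrite (le_trans _ (uK true)).
elim: p => [|p IHp] /=; first by rewrite normr0 mul0r addr0.
have := uK (0 <= D p); move: IHp; rewrite -natr1 mulrDl mul1r !ler_norml.
have : 0 <= p%:R * s by rewrite mulr_ge0.
move: (p%:R * s) (D p) => ps x ps0.
by case: (leP 0 x) => x0 /andP[? ?] /andP[? ?]; apply/andP; split; lra.
Qed.

(** * Points near which [phi] oscillates *)

Section oscillation.
Context {R : realType} {X : completeMetricType R} (phi : X -> R).
Hypothesis cphi : continuous phi.

(** The strict distance bounds leave room to move [x] while [y] and [z] stay fixed; this makes the
    set open, hence Borel. *)
Definition oscillation_set (eta d : R) : set X :=
  [set x | exists y z, [/\ mdist x y < d, mdist x z < d & eta < `|phi y - phi z|]].

Lemma oscillation_set_open (eta d : R) : open (oscillation_set eta d).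
Proof.
rewrite openE => x [y [z [xy xz yz]]].
have e0 : 0 < Num.min (d - mdist x y) (d - mdist x z) by rewrite lt_min !subr_gt0 xy.
apply/metricType_numDomainType.nbhs_mdistP; exists (Num.min (d - mdist x y) (d - mdist x z)) => // w /= xw.
have /andP[wy wz] : (mdist x w < d - mdist x y) && (mdist x w < d - mdist x z).
  by rewrite -lt_min.
exists y, z; split=> //.
  by have := metric_triangle w x y; rewrite (metric_sym w x); lra.
by have := metric_triangle w x z; rewrite (metric_sym w x); lra.
Qed.

Lemma oscillation_set_le (eta d e : R) : d <= e ->
  oscillation_set eta d `<=` oscillation_set eta e.
Proof.
move=> de x [y [z [xy xz yz]]].
by exists y, z; split=> //; exact: lt_le_trans de.
Qed.

Lemma oscillation_set_bigcap (eta : R) : 0 < eta ->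
  \bigcap_n oscillation_set eta n.+1%:R^-1 = set0.
Proof.
move=> eta0; rewrite -subset0 => x xE.
have /cvgrPdist_lt/(_ (eta / 2)) := @cphi x; rewrite divr_gt0// => /(_ isT).
move=> /metricType_numDomainType.nbhs_mdistP[e /= e0 near_x].
have [n ne] := exists_natSinv_lt e0.
have [y [z [xy xz yz]]] := xE n I.
have := near_x y (lt_trans xy ne); have := near_x z (lt_trans xz ne); rewrite /= => a b.
have := ler_distD (phi x) (phi y) (phi z); rewrite (distrC (phi y) (phi x)); lra.
Qed.

Lemma oscillation_setN (eta d : R) x y : ~ oscillation_set eta d x ->
  mdist x y < d -> `|phi y - phi x| <= eta.
Proof.
move=> xE xy; rewrite leNgt; apply/negP => yx; apply: xE.
by exists y, x; split=> //; rewrite mdistxx (le_lt_trans _ xy)// mdist_ge0.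
Qed.

Lemma oscillation_set_measurable (eta d : R) :
  measurable (oscillation_set eta d : set (borelType X)).
Proof. by apply: sub_sigma_algebra; exact: oscillation_set_open. Qed.

Lemma continuous_measurable_borel : measurable_fun [set: borelType X] phi.
Proof.
apply: (measurability _ (RGenOpens.measurableE R)).
move=> _ [_ [a [b ->] <-]]; rewrite setTI; apply: sub_sigma_algebra.
by move/continuousP : cphi; apply; exact: interval_open.
Qed.

(** Continuity at each point makes these sets shrink to the empty set with [d], and the measure is
    continuous from above. This is the substitute for uniform continuity. *)
Lemma oscillation_set_small (mu : probability (borelType X) R) (eta c : R) :
  0 < eta -> 0 < c -> exists2 d, 0 < d & (mu (oscillation_set eta d) <= c%:E)%E.
Proof.
move=> eta0 c0.
pose F n : set (borelType X) := oscillation_set eta n.+1%:R^-1.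
have mF n : measurable (F n) by exact: oscillation_set_measurable.
have F0 : \bigcap_n F n = set0 by exact: oscillation_set_bigcap.
have cvF : mu \o F @ \oo --> mu (\bigcap_n F n).
  apply: nonincreasing_cvg_mu => //.
  - by rewrite (le_lt_trans (probability_le1 _ _))// ltry.
  - by rewrite F0.
  - move=> m n le_mn; apply/subsetPset; apply: oscillation_set_le.
    by rewrite lef_pV2 ?posrE// ler_nat.
move: cvF; rewrite F0 measure0 => /fine_cvgP[_ /cvgrPdist_lt/(_ c c0)[n _]].
move=> /(_ n (leqnn n)) /=; rewrite sub0r normrN => Fnc.
exists n.+1%:R^-1; first by rewrite invr_gt0.
have fin : mu (F n) \is a fin_num by exact: fin_num_measure.
rewrite -[leLHS](fineK fin) lee_fin (le_trans _ (ltW Fnc))//.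
exact: ler_norm.
Qed.

End oscillation.

(** * Orbit segments with controlled averages, obtained from an invariant measure *)

Section invariant_averages.
Context {R : realType} {X : completeMetricType R} (T : X -> X).
Hypothesis cT : continuous T.
Variable mu : probability (borelType X) R.
Hypothesis mu_inv : invariant_measures T mu.

Lemma continuous_measurable_borel_map :
  measurable_fun [set: borelType X] (T : borelType X -> borelType X).
Proof.
apply: (@measurability _ _ (borelType X) (borelType X) _ _ (@open X)) => //.
move=> _ [A oA <-]; rewrite setTI; apply: sub_sigma_algebra.
by move/continuousP : cT; apply.
Qed.

Let mT := continuous_measurable_borel_map.

Lemma bounded_integrable (g : borelType X -> R) (M : R) :
  measurable_fun [set: borelType X] g -> (forall x, `|g x| <= M) ->
  mu.-integrable [set: borelType X] (EFin \o g).
Proof.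
move=> mg gM; apply: measurable_bounded_integrable => //.
  by rewrite (le_lt_trans (probability_le1 _ _))// ltry.
by exists M; split; [rewrite num_real | move=> N MN x _; exact: le_trans (ltW MN)].
Qed.

Lemma iter_measurable (j : nat) :
  measurable_fun [set: borelType X] (iter j T : borelType X -> borelType X).
Proof.
elim: j => [|j IHj]; first exact: measurable_id.
exact: (measurableT_comp mT IHj).
Qed.

Lemma integral_iter (g : borelType X -> R) (M : R) (j : nat) :
  measurable_fun [set: borelType X] g -> (forall x, `|g x| <= M) ->
  (\int[mu]_x (g (iter j T x))%:E = \int[mu]_x (g x)%:E)%E.
Proof.
move=> mg gM; elim: j => // j <-.
have mgj : measurable_fun [set: borelType X] (fun x => g (iter j T x)).
  exact: (measurableT_comp mg (iter_measurable j)).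
pose T' : {mfun borelType X >-> borelType X} :=
  HB.pack (T : borelType X -> borelType X) (isMeasurableFun.Build _ _ _ _ _ mT).
(* Invariance identifies [mu] with its image under [T]; a change of variables then raises the
   exponent by one. *)
rewrite [RHS](eq_measure_integral (pushforward mu T'));
  last by move=> A mA _; exact/esym/mu_inv.
rewrite (@integral_pushforward _ _ (borelType X) (borelType X)) //.
- by apply: eq_integral => x _ /=; rewrite -iterSr.
- exact/measurable_EFinP.
- apply: (@bounded_integrable (fun x => g (iter j T (T x))) M) => [|x]; last exact: gM.
  exact: (measurableT_comp mgj mT).
Qed.

(** By invariance the orbit sum has integral [m%:R * I], so it cannot exceed [m%:R * (I + e)]
    everywhere. *)
Lemma exists_orbit_sum_le (g : borelType X -> R) (M I : R) (m : nat) (e : R) :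
    measurable_fun [set: borelType X] g -> (forall x, `|g x| <= M) ->
    (\int[mu]_x (g x)%:E = I%:E)%E -> (0 < m)%N -> 0 < e ->
  exists x, \sum_(j < m) g (iter j T x) <= m%:R * (I + e).
Proof.
move=> mg gM gI m0 e0; apply: contrapT => no_x.
have sum_ge x : m%:R * (I + e) <= \sum_(j < m) g (iter j T x).
  by rewrite leNgt; apply/negP => /ltW lt_x; apply: no_x; exists x.
have int_g j : mu.-integrable [set: borelType X] (fun x => (g (iter j T x))%:E).
  apply: (@bounded_integrable (fun x => g (iter j T x)) M) => [|x]; last exact: gM.
  exact: (measurableT_comp mg (iter_measurable j)).
have : (\int[mu]_x (m%:R * (I + e))%:E <=
    \int[mu]_x (\sum_(j < m) (g (iter j T x))%:E))%E.
  apply: le_integral => //.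
  - by apply: (@bounded_integrable (cst (m%:R * (I + e))) `|m%:R * (I + e)|).
  - exact: integrable_sum.
  - by move=> x _; rewrite sumEFin lee_fin.
have int_cst (c : R) : (\int[mu]_x c%:E = c%:E)%E.
  have muT : mu [set: borelType X] = 1%E by exact: probability_setT.
  by rewrite integral_cst// [X in (_ * X)%E]muT mule1.
rewrite integral_sum// int_cst.
under eq_bigr do rewrite (integral_iter _ mg gM) gI.
rewrite sumEFin lee_fin sumr_const card_ord -[I *+ m]mulr_natl.
by rewrite ler_pM2l ?ltr0n// gerDl leNgt e0.
Qed.

(** Both bounds come from one orbit sum, that of [psi] plus a large multiple of the indicator of the
    oscillation set. The scale [d0] does not depend on [m], so it can be fixed before the length of
    the blocks. The function [psi] is meant to be [phi] or [- phi]. *)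
Lemma exists_robust_orbit (phi psi : X -> R) (M I tau : R) :
    continuous phi -> continuous psi -> (forall x, `|psi x| <= M) ->
    (\int[mu]_x (psi x)%:E = I%:E)%E -> 0 < tau ->
  exists2 d0, 0 < d0 & forall d m, d <= d0 -> (0 < m)%N -> exists x,
    \sum_(j < m) psi (iter j T x) <= m%:R * (I + tau) /\
    \sum_(j < m) \1_(oscillation_set phi tau d) (iter j T x) <= m%:R * tau :> R.
Proof.
move=> cphi cpsi psiM psiI tau0.
have M0 : 0 <= M := le_trans (normr_ge0 _) (psiM point).
(* As the sum of [psi] is at least [- (m%:R * M)], the penalty part is at most
   [m%:R * (|I| + M + tau)]; this [C] turns that into at most [m%:R * tau] visits. The measure of
   the set is then taken so small that the penalty adds at most [tau / 2] to the integral. *)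
have [C C0 Ctau] : exists2 C, 0 < C & C * tau = `|I| + M + tau.
  exists ((`|I| + M + tau) / tau); last by rewrite divfK ?gt_eqF.
  by apply: divr_gt0 => //; have := normr_ge0 I; lra.
have c0 : 0 < tau / 2 / C by apply: divr_gt0 => //; exact: divr_gt0.
have [d0 d00 mud0] := oscillation_set_small cphi mu tau0 c0.
exists d0 => // d m dd0 m0.
set E : set (borelType X) := oscillation_set phi tau d.
have mE : measurable E by exact: oscillation_set_measurable.
have muE : (mu E <= (tau / 2 / C)%:E)%E.
  apply: le_trans mud0; apply: le_measure; rewrite ?inE//.
    exact: oscillation_set_measurable.
  exact: oscillation_set_le.
have [r muEr rC] : exists2 r, mu E = r%:E & C * r <= tau / 2.
  have muE_fin : mu E \is a fin_num by exact: fin_num_measure.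
  exists (fine (mu E)); first exact/esym/fineK.
  by rewrite mulrC -ler_pdivlMr// -lee_fin (fineK muE_fin).
pose g (x : borelType X) := psi x + C * \1_E x.
have mpsi := continuous_measurable_borel cpsi.
have mind : measurable_fun [set: borelType X] (fun x => C * \1_E x : R).
  by apply: measurable_funM => //; exact: measurable_indic.
have ind01 (x : X) : 0 <= (\1_E x : R) <= 1.
  by rewrite indicE; case: (_ \in _); rewrite /= ?lexx ler01.
have gM x : `|g x| <= M + C.
  have /andP[ind0 ind1] := ind01 x.
  rewrite (le_trans (ler_normD _ _))// lerD// ger0_norm.
    by rewrite ler_piMr ?(ltW C0).
  by rewrite mulr_ge0 ?(ltW C0).
have int_psi : mu.-integrable [set: borelType X] (EFin \o psi).
  exact: (@bounded_integrable _ M).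
have gI : (\int[mu]_x (g x)%:E = (I + C * r)%:E)%E.
  rewrite (_ : (fun x => (g x)%:E) =
      (fun x : borelType X => (psi x)%:E + (C%:E * (\1_E x)%:E))%E); last first.
    by apply/funext => x; rewrite /g EFinD EFinM.
  have int_E : mu.-integrable [set: borelType X] (fun x => (\1_E x)%:E).
    exact: integrable_indic.
  rewrite integralD//; last exact: integrableZl.
  rewrite integralZl// integral_indic// setIT psiI EFinD EFinM.
  by congr (_ + _ * _)%E; exact: muEr.
have t2 : 0 < tau / 2 by rewrite divr_gt0.
have mg : measurable_fun [set: borelType X] g by exact: measurable_funD.
have [x] := exists_orbit_sum_le mg gM gI m0 t2.
rewrite /g big_split/= -mulr_sumr => gx; exists x.
have mR : 0 < m%:R :> R by rewrite ltr0n.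
have le_mI : m%:R * (I + C * r + tau / 2) <= m%:R * (I + tau).
  by rewrite ler_pM2l//; lra.
set S := \sum_(j < m) \1_E _ in gx *.
have S0 : 0 <= S by apply: sumr_ge0 => j _; case/andP: (ind01 (iter j T x)).
have CS0 : 0 <= C * S by rewrite mulr_ge0// ltW.
split; first by lra.
have psi_ge : - (m%:R * M) <= \sum_(j < m) psi (iter j T x).
  rewrite -mulrN mulr_natl.
  have -> : - M *+ m = \sum_(j < m) - M by rewrite sumr_const card_ord.
  by apply: ler_sum => j _; have := psiM (iter j T x); rewrite ler_norml => /andP[].
have CS : C * S <= m%:R * (`|I| + M + tau).
  have : m%:R * I <= m%:R * `|I| by rewrite ler_pM2l// ler_norm.
  rewrite !mulrDr in le_mI gx *; lra.
rewrite -(ler_pM2l C0) (le_trans CS)//.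
by rewrite mulrCA Ctau.
Qed.

End invariant_averages.

(** * One stage: prolonging an orbit segment while its average is steered to a target *)

Section stage.
Context {R : realType} {X : completeMetricType R} (T : X -> X) (phi : X -> R).
Variable M : R.
Hypothesis phiM : forall x, `|phi x| <= M.

Let M_ge0 : 0 <= M. Proof. exact: le_trans (normr_ge0 _) (phiM point). Qed.

Definition orbit_sum (z : X) (k : nat) : R := \sum_(j < k) phi (iter j T z).

Lemma orbit_sumD z a b :
  orbit_sum z (a + b) = orbit_sum z a + orbit_sum (iter a T z) b.
Proof.
rewrite /orbit_sum big_split_ord/=; congr (_ + _).
by apply: eq_bigr => j _; rewrite addnC iterD.
Qed.

Lemma orbit_sum_le z (t : R) k : `|t| <= M ->
  `|orbit_sum z k - k%:R * t| <= 2 * M * k%:R.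
Proof.
move=> tM; elim: k => [|k IHk].
  by rewrite /orbit_sum big_ord0 mul0r subrr normr0 mulr0.
rewrite /orbit_sum big_ord_recr/= -/(orbit_sum z k).
move: IHk (phiM (iter k T z)) tM; rewrite -natr1 !ler_norml.
by move=> /andP[? ?] /andP[? ?] /andP[? ?]; apply/andP; split; nra.
Qed.

(** A time outside [L] or in the oscillation set costs at most [2 * M], any other time at most
    [tau]; each of the two kinds of bad times has at most [m%:R * tau] members. *)
Lemma block_orbit_sum (x w : X) (m : nat) (tau d : R) (L : {set 'I_m}) :
    \sum_(j < m) \1_(oscillation_set phi tau d) (iter j T x) <= m%:R * tau ->
    (1 - tau) * m%:R <= #|L|%:R -> 0 <= tau ->
    (forall j : 'I_m, j \in L -> mdist (iter j T x) (iter j T w) < d) ->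
  `|orbit_sum w m - orbit_sum x m| <= m%:R * ((1 + 4 * M) * tau).
Proof.
move=> osc cardL tau0 xw.
have pointwise (j : 'I_m) : `|phi (iter j T w) - phi (iter j T x)| <=
    tau + 2 * M * (\1_(oscillation_set phi tau d) (iter j T x) + (j \notin L)%:R).
  have trivial_bound : `|phi (iter j T w) - phi (iter j T x)| <= 2 * M.
    have := ler_normB (phi (iter j T w)) (phi (iter j T x)).
    by have := phiM (iter j T w); have := phiM (iter j T x); lra.
  have M0 := M_ge0.
  rewrite indicE; have [jL|jL] := boolP (j \in L) => /=; last first.
    by case: (_ \in _) => /=; lra.
  case: (boolP (_ \in _)) => [_|/negP] /=; first by lra.
  by rewrite inE => /oscillation_setN/(_ (xw _ jL)); lra.
rewrite /orbit_sum -sumrB (le_trans (ler_norm_sum _ _ _))//.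
rewrite (le_trans (ler_sum _ (fun j _ => pointwise j)))//.
rewrite big_split/= -mulr_sumr big_split/= sumr_const card_ord -[tau *+ m]mulr_natl.
have -> : \sum_(j < m) (j \notin L)%:R = m%:R - #|L|%:R :> R.
  have : m%:R = #|L|%:R + #|~: L|%:R :> R by rewrite -natrD cardsC card_ord.
  move=> ->; rewrite addrAC subrr add0r -natr_sum -sum1_card [in RHS]big_mkcond/=.
  by congr (_%:R); apply: eq_bigr => j _; rewrite inE; case: (_ \in _).
move: osc cardL; set A := \sum_(j < m) _; have := M_ge0; nra.
Qed.

(** The specification consists of the segment built so far and [q] blocks of equal length. Its first
    piece is traced without exceptional times, so the past is preserved up to [e]. *)
Lemma trace_blocks (e tau : R) (N n m q : nat) (y : X) (x : nat -> X) :
    (forall xi, specification xi -> (forall p, p \in xi -> (N <= p.2)%N) ->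
       exists y, approx_traces T e tau tau xi y) ->
    (0 < n)%N -> (0 < m)%N -> (N <= n)%N -> (N <= m)%N ->
  exists y' (s : nat -> nat),
    (forall j, (j < n)%N -> mdist (iter j T y) (iter j T y') < e) /\
    forall j, (j < q)%N -> (s j)%:R <= tau * m%:R /\
      exists2 L : {set 'I_m}, (1 - tau) * m%:R <= #|L|%:R &
        forall i : 'I_m, i \in L -> mdist (iter i T (x j))
          (iter (i + (n + j * m + \sum_(l < j.+1) s l)) T y') < e.
Proof.
move=> HN n0 m0 Nn Nm.
pose xi := (y, n) :: [seq (x i, m) | i <- iota 0 q].
have xiP p : p \in xi -> p = (y, n) \/ p.2 = m.
  by rewrite inE => /predU1P[|/mapP[i _ ->]]; [left | right].
have nth_xi j : (j < q)%N -> nth (point, 0%N) xi j.+1 = (x j, m).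
  by move=> lt_j; rewrite /= (nth_map 0%N) ?size_iota// nth_iota.
have size_xi : size xi = q.+1 by rewrite /= size_map size_iota.
have [||y' [y'0 [s sP]]] := HN xi.
- by split=> // p /xiP[->|->].
- by move=> p /xiP[->|->].
exists y', s; split.
  by move=> j lt_j; exact: (y'0 (Ordinal lt_j) (finset.in_setT _)).
move=> j lt_j; move: (sP j); rewrite size_xi ltnS => /(_ lt_j).
rewrite nth_xi//= => -[sj [L cardL Ly]]; split=> //; exists L => // i iL.
have := Ly i iL; rewrite -iterD; congr (mdist _ (iter (_ + _) _ _) < _).
rewrite big_split/= addnC; congr addn.
rewrite big_ord_recl/=; congr addn.
rewrite -[in RHS](card_ord j) -sum_nat_const; apply: eq_bigr => i' _.
by rewrite /bump/= add0n -[LHS]/(nth (point, 0%N) xi i'.+1).2 nth_xi// (ltn_trans _ lt_j).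
Qed.

(** Three errors add up: the steering of the exact block sums, the gaps and imperfect tracing inside
    each block, and the unfinished block at time [k]. The estimate is stated for every [z] close to
    [y'], because later stages still perturb the point; [2 * e <= d] absorbs both perturbations. *)
Lemma stage (e tau d t : R) (N n m q : nat) (y : X) (x : bool -> X) :
    (forall xi, specification xi -> (forall p, p \in xi -> (N <= p.2)%N) ->
       exists y, approx_traces T e tau tau xi y) ->
    0 < tau -> tau <= 1 -> 2 * e <= d -> `|t| <= M ->
    (0 < n)%N -> (0 < m)%N -> (N <= n)%N -> (N <= m)%N ->
    orbit_sum (x true) m <= m%:R * (t + tau) ->
    m%:R * (t - tau) <= orbit_sum (x false) m ->
    (forall b, \sum_(j < m) \1_(oscillation_set phi tau d) (iter j T (x b)) <=
      m%:R * tau) ->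
  exists y' n', [/\ (n + q * m <= n')%N,
    forall j, (j < n)%N -> mdist (iter j T y) (iter j T y') < e &
    forall z, (forall j, (j < n')%N -> mdist (iter j T y') (iter j T z) <= e) ->
      forall k, (n <= k <= n')%N ->
      `|(orbit_sum z k - k%:R * t) - (orbit_sum z n - n%:R * t)| <=
        (6 * M + 2) * (m%:R + tau * (k%:R - n%:R))].
Proof.
move=> HN tau0 tau1 ed tM n0 m0 Nn Nm x_lo x_hi x_osc.
have M0 := M_ge0.
have mR : 0 < m%:R :> R by rewrite ltr0n.
have mtau : 0 <= m%:R * tau by rewrite mulr_ge0 ?ltW.
have [||b|c cP] := @steering R (fun b => orbit_sum (x b) m) (m%:R * t)
    (2 * M * m%:R) (m%:R * tau) mtau.
- by rewrite -mulrDr.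
- by rewrite -mulrBr.
- exact: orbit_sum_le.
have [y' [s [yy' sP]]] := @trace_blocks e tau N n m q y (x \o c) HN n0 m0 Nn Nm.
(* Time at which the first [j] blocks are complete; the gap [s j] follows it. *)
pose Q j := (n + j * m + \sum_(l < j) s l)%N.
have QS j : Q j.+1 = (Q j + s j + m)%N.
  by rewrite /Q big_ord_recr/= mulSn; lia.
have Q_mono : {homo Q : i j / (i <= j)%N}.
  by apply: homo_leq => [//||j]; [exact: leq_trans | rewrite QS; lia].
have Qge j : (n + j * m <= Q j)%N by rewrite /Q leq_addr.
exists y', (Q q); split=> // z zy' k.
pose F k := orbit_sum z k - k%:R * t.
rewrite -/(F k) -/(F n) => /andP[le_nk le_kQ].
have F_lip a b : `|F (a + b)%N - F a| <= 2 * M * b%:R.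
  have := orbit_sum_le (iter a T z) b tM.
  by rewrite /F orbit_sumD natrD mulrDl; congr (`|_| <= _); ring.
(* The gap contributes [2 * M] and the tracing error [1 + 4 * M], whence the factor [6 * M + 1]. *)
have Fblock p : (p < q)%N ->
    `|F (Q p.+1) - F (Q p) - (orbit_sum (x (c p)) m - m%:R * t)| <=
      (6 * M + 1) * (m%:R * tau).
  move=> lt_pq; have [sp [L cardL Lp]] := sP p lt_pq.
  have Lz (i : 'I_m) : i \in L ->
      mdist (iter i T (x (c p))) (iter i T (iter (Q p + s p) T z)) < d.
    move=> iL; rewrite -iterD.
    have -> : (i + (Q p + s p) = i + (n + p * m + \sum_(l < p.+1) s l))%N.
      by rewrite /Q big_ord_recr/= !addnA.
    have lt_i : (i + (n + p * m + \sum_(l < p.+1) s l) < Q q)%N.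
      apply: leq_trans (Q_mono _ _ lt_pq).
      by rewrite /Q mulSn; have := ltn_ord i; lia.
    have := Lp i iL; have := zy' _ lt_i; set v := iter _ T y'; set v' := iter _ T z.
    by have := metric_triangle (iter i T (x (c p))) v v'; rewrite /=; lra.
  have := block_orbit_sum (x_osc (c p)) cardL (ltW tau0) Lz.
  have := F_lip (Q p) (s p); have : 2 * M * (s p)%:R <= 2 * M * (tau * m%:R).
    by rewrite ler_wpM2l// mulr_ge0.
  have -> : F (Q p.+1) - F (Q p) - (orbit_sum (x (c p)) m - m%:R * t) =
      (F (Q p + s p)%N - F (Q p)) +
      (orbit_sum (iter (Q p + s p) T z) m - orbit_sum (x (c p)) m).
    by rewrite QS /F orbit_sumD (natrD _ (Q p + s p) m); ring.
  set A := F _ - F _; set B := orbit_sum _ _ - orbit_sum _ _.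
  by have := ler_normD A B; lra.
have Fblocks p : (p <= q)%N ->
    `|F (Q p) - F n - \sum_(i < p) (orbit_sum (x (c i)) m - m%:R * t)| <=
      p%:R * ((6 * M + 1) * (m%:R * tau)).
  elim: p => [_|p IHp lt_pq].
    by rewrite big_ord0 /Q big_ord0 mul0n !addn0 subrr subr0 normr0 mul0r.
  have := IHp (ltnW lt_pq); have := Fblock p lt_pq.
  rewrite big_ord_recr/= -natr1 mulrDl mul1r.
  set A := F _ - F _ - _; set B := _ - _ - \sum_(i < p) _ => hA hB.
  have -> : F (Q p.+1) - F n - (\sum_(i < p) (orbit_sum (x (c i)) m - m%:R * t) +
      (orbit_sum (x (c p)) m - m%:R * t)) = B + A by rewrite /A /B; ring.
  by have := ler_normD B A; lra.
(* As [tau <= 1], a gap is no longer than a block, so fewer than two block lengths or exactly two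
   separate [k] from the last complete block used. *)
have [p [le_pq le_Qk lt_kQ]] : exists p, [/\ (p <= q)%N, (Q p <= k)%N &
    (k <= Q p + 2 * m)%N].
  have : forall r, (r <= q)%N -> (k <= Q r)%N -> exists p,
      [/\ (p <= q)%N, (Q p <= k)%N & (k <= Q p + 2 * m)%N]; last by move=> /(_ q); exact.
  elim=> [|r IHr] le_rq.
    rewrite /Q big_ord0 mul0n !addn0 => le_kn.
    by exists 0%N; rewrite /Q big_ord0 mul0n !addn0; split=> //; lia.
  have [le_kr _|lt_rk] := leqP k (Q r); first by apply: IHr => //; exact: ltnW.
  rewrite QS => le_k; exists r; split; [exact: ltnW | exact: ltnW |].
  have [sr _] := sP r le_rq.
  have : (s r <= m)%N by rewrite -(ler_nat R) (le_trans sr)// ler_piMl.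
  by lia.
have := Fblocks p le_pq; have := cP p; have := F_lip (Q p) (k - Q p)%N.
rewrite subnKC//.
have : (k - Q p)%:R <= 2 * m%:R :> R by rewrite -natrM ler_nat; lia.
have : p%:R * m%:R <= k%:R - n%:R :> R.
  rewrite lerBrDl -natrM -natrD ler_nat (leq_trans (Qge p))//.
set pm := p%:R * m%:R; set r := (k - Q p)%:R.
set A := F k - F (Q p); set B := \sum_(i < p) _; set D := _ - B => pmk r2m hA hB hD.
have -> : F k - F n = A + (B + D) by rewrite /A /D; ring.
have := ler_normD A (B + D); have := ler_normD B D.
have : 2 * M * r <= 2 * M * (2 * m%:R) by rewrite ler_wpM2l// mulr_ge0.
have : (6 * M + 2) * (tau * pm) <= (6 * M + 2) * (tau * (k%:R - n%:R)).
  by rewrite ler_wpM2l ?addr_ge0 ?mulr_ge0// ler_wpM2l// ltW.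
have e1 : p%:R * (m%:R * tau) = tau * pm by rewrite /pm; ring.
have e2 : p%:R * ((6 * M + 1) * (m%:R * tau)) = (6 * M + 1) * (tau * pm).
  by rewrite /pm; ring.
rewrite e1 in hB; rewrite e2 in hD; lra.
Qed.

End stage.

Lemma dist_average_le {R : realType} (a s t c : R) : 0 < a ->
  (`|a^-1 * s - t| <= c) = (`|s - a * t| <= c * a).
Proof.
move=> a0; have -> : s - a * t = (a^-1 * s - t) * a by field; rewrite gt_eqF.
by rewrite normrM (gtr0_norm a0) ler_pM2r.
Qed.

(** * From estimates on stages to limits of averages *)

Section staged_averages.
Context {R : realType} (S t : nat -> R) (n m : nat -> nat) (M C : R).
Hypotheses (M_ge0 : 0 <= M) (C_ge0 : 0 <= C).
Hypothesis m_gt0 : forall k, (0 < m k)%N.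
Hypothesis nm : forall k, (k.+1 * m k <= n k)%N.
Hypothesis nS : forall k, (k.+1 * n k <= n k.+1)%N.
Hypothesis SM : forall k j, `|S j - j%:R * t k| <= 2 * M * j%:R.
Hypothesis St : forall k j, (n k <= j <= n k.+1)%N ->
  `|(S j - j%:R * t k) - (S (n k) - (n k)%:R * t k)| <=
    C * ((m k)%:R + k.+1%:R^-1 * (j%:R - (n k)%:R)).

Let w (k : nat) : R := k.+1%:R^-1.

Let w_gt0 k : 0 < w k. Proof. by rewrite invr_gt0. Qed.

Let n_ge k : (k < n k)%N.
Proof. by apply: leq_trans (nm k); rewrite leq_pmulr. Qed.

Let n_le k : (n k <= n k.+1)%N.
Proof. by apply: leq_trans (nS k); rewrite leq_pmull. Qed.

Let mR k : (m k)%:R <= w k * (n k)%:R.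
Proof. by rewrite mulrC ler_pdivlMr// mulrC -natrM ler_nat. Qed.

Let nR k : (n k)%:R <= w k * (n k.+1)%:R.
Proof. by rewrite mulrC ler_pdivlMr// mulrC -natrM ler_nat. Qed.

(** Here [S] stands for the orbit sums, and stage [k] runs from time [n k] to time [n k.+1]. Both
    the past [n k] and the block length [m k] are at most [w k * n k.+1], so the average at the end
    forgets the earlier targets. *)
Lemma stage_end k :
  `|S (n k.+1) - (n k.+1)%:R * t k| <= w k * (2 * M + 2 * C) * (n k.+1)%:R.
Proof.
have := St (k := k) (j := n k.+1); rewrite leqnn n_le => /(_ isT).
have := SM k (n k); set A := S (n k) - _; set B := S (n k.+1) - _ => hA hBA.
have := ler_normD (B - A) A; rewrite subrK.
have nle : (n k)%:R <= (n k.+1)%:R :> R by rewrite ler_nat.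
have n0 : 0 <= (n k)%:R :> R by [].
have w0 := w_gt0 k.
have : 2 * M * (n k)%:R <= 2 * M * (w k * (n k.+1)%:R) by rewrite ler_wpM2l ?mulr_ge0.
have : C * ((m k)%:R + w k * ((n k.+1)%:R - (n k)%:R)) <=
    C * (w k * (n k.+1)%:R + w k * (n k.+1)%:R).
  rewrite ler_wpM2l// lerD// ?ler_pM2l ?gerBl//.
  by rewrite (le_trans (mR k))// ler_pM2l.
by rewrite -/(w k) in hBA *; lra.
Qed.

(** The averages at the ends of the stages follow the targets, so a limit of the former is a limit
    of the latter. *)
Lemma cvg_average_target L :
  k%:R^-1 * S k @[k --> \oo] --> L -> forall e, 0 < e ->
  exists K, forall k, (K <= k)%N -> `|t k - L| <= e.
Proof.
move=> /cvgrPdist_le SL e e0.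
have [J _ JP] := SL (e / 2) (divr_gt0 e0 (ltr0n _ 2)).
have [K wK] : exists K, w K * (2 * M + 2 * C) <= e / 2.
  have D0 : 0 < 2 * M + 2 * C + 1 by rewrite ltr_wpDl ?addr_ge0 ?mulr_ge0.
  have [K Ke] := exists_natSinv_lt (divr_gt0 (divr_gt0 e0 (ltr0n _ 2)) D0).
  exists K; move: Ke; rewrite ltr_pdivlMr// => /ltW; apply: le_trans.
  by rewrite ler_pM2l ?w_gt0// lerDl.
exists (maxn J K) => k; rewrite geq_max => /andP[Jk Kk].
have nk0 : 0 < (n k.+1)%:R :> R by rewrite ltr0n (leq_trans _ (n_ge _)).
have : `|L - (n k.+1)%:R^-1 * S (n k.+1)| <= e / 2.
  by apply: JP => /=; have := n_ge k.+1; lia.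
have : `|(n k.+1)%:R^-1 * S (n k.+1) - t k| <= e / 2.
  rewrite dist_average_le// (le_trans (stage_end k))// ler_pM2r//.
  apply: le_trans wK; rewrite ler_wpM2r ?addr_ge0 ?mulr_ge0//.
  by rewrite lef_pV2 ?posrE// ler_nat.
set v := _ * S _ => h1 h2; have := ler_distD v (t k) L.
by rewrite (distrC (t k) v) (distrC v L); lra.
Qed.

Lemma target_cvg_average L :
  (forall e, 0 < e -> exists K, forall k, (K <= k)%N -> `|t k - L| <= e) ->
  k%:R^-1 * S k @[k --> \oo] --> L.
Proof.
move=> tL; apply/cvgrPdist_le => e e0.
have [K1 K1P] := tL (e / 4) (divr_gt0 e0 (ltr0n _ 4)).
have [K2 wK] : exists K, w K * (2 * M + 4 * C) <= e / 2.
  have D0 : 0 < 2 * M + 4 * C + 1 by rewrite ltr_wpDl ?addr_ge0 ?mulr_ge0.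
  have [K Ke] := exists_natSinv_lt (divr_gt0 (divr_gt0 e0 (ltr0n _ 2)) D0).
  exists K; move: Ke; rewrite ltr_pdivlMr// => /ltW; apply: le_trans.
  by rewrite ler_pM2l ?w_gt0// lerDl.
pose K := maxn K1 K2; exists (n K.+1) => // j /= le_j.
(* The time [j] falls in stage [k.+1]; the shift guarantees a preceding stage [k], whose end
   estimate controls the sum up to [n k.+1]. *)
have [k [Kk le_nj le_jn]] : exists k, [/\ (K <= k)%N, (n k.+1 <= j)%N & (j <= n k.+2)%N].
  have : forall r, (j <= n (K + r).+2)%N -> exists k,
      [/\ (K <= k)%N, (n k.+1 <= j)%N & (j <= n k.+2)%N].
    elim=> [|r IHr]; first by rewrite addn0 => le_jn; exists K.
    have [/IHr//|lt_nj] := leqP j (n (K + r).+2).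
    by rewrite addnS => le_jn; exists (K + r).+1; rewrite leqW ?leq_addr// ltnW.
  by move=> /(_ j); apply; have := n_ge (K + j).+2; lia.
have j0 : 0 < j%:R :> R by rewrite ltr0n (leq_trans _ le_nj)// (leq_trans _ (n_ge _)).
rewrite distrC dist_average_le//.
have := St (k := k.+1) (j := j); rewrite le_nj le_jn => /(_ isT).
have := stage_end k; have := mR k.+1.
have t1 : `|t k - L| <= e / 4 by apply: K1P; rewrite (leq_trans _ Kk)// leq_maxl.
have t2 : `|t k.+1 - L| <= e / 4.
  by apply: K1P; rewrite leqW// (leq_trans _ Kk)// leq_maxl.
have wk : w k * (2 * M + 4 * C) <= e / 2.
  apply: le_trans wK; rewrite ler_wpM2r ?addr_ge0 ?mulr_ge0//.
  by rewrite lef_pV2 ?posrE// ler_nat ltnS (leq_trans _ Kk)// leq_maxr.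
have ww : w k.+1 <= w k by rewrite lef_pV2 ?posrE// ler_nat.
rewrite -/(w k.+1).
have w1 := w_gt0 k.+1.
have nj : (n k.+1)%:R <= j%:R :> R by rewrite ler_nat.
have n0 : 0 <= (n k.+1)%:R :> R by [].
move: (n k.+1) (m k.+1) (w k.+1) (w k) ww w1 wk nj n0 => nn mm w' w0.
move=> ww w1 wk nj n0 mw hE hSt.
set A := (_ - _) - (_ - _) in hSt; set B := _ - _ in hE.
(* Error within the current stage, error at the end of the previous one, and a weighted sum of the
   distances of their two targets from [L]. *)
have -> : S j - j%:R * L =
    A + (B + (nn%:R * (t k - L) + (j%:R - nn%:R) * (t k.+1 - L))).
  by rewrite /A /B; ring.
have hT1 : `|nn%:R * (t k - L)| <= nn%:R * (e / 4).
  by rewrite normrM ger0_norm// ler_wpM2l.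
have hT2 : `|(j%:R - nn%:R) * (t k.+1 - L)| <= (j%:R - nn%:R) * (e / 4).
  by rewrite normrM ger0_norm ?subr_ge0// ler_wpM2l// subr_ge0.
have := ler_normD A (B + (nn%:R * (t k - L) + (j%:R - nn%:R) * (t k.+1 - L))).
have := ler_normD B (nn%:R * (t k - L) + (j%:R - nn%:R) * (t k.+1 - L)).
have := ler_normD (nn%:R * (t k - L)) ((j%:R - nn%:R) * (t k.+1 - L)).
have h1 : C * (mm%:R + w' * (j%:R - nn%:R)) <= C * (w0 * j%:R).
  rewrite ler_wpM2l// (@le_trans _ _ (w' * j%:R)) ?ler_wpM2r//.
  by move: mw; rewrite mulrBr; lra.
have h2 : w0 * (2 * M + 2 * C) * nn%:R <= w0 * (2 * M + 2 * C) * j%:R.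
  by rewrite ler_wpM2l// mulr_ge0 ?addr_ge0 ?mulr_ge0//; lra.
have h3 : w0 * (2 * M + 4 * C) * j%:R <= e / 2 * j%:R by rewrite ler_pM2r.
have h5 : 0 <= e * j%:R by rewrite mulr_ge0 ?ltW.
have h4 : 0 <= C * (w0 * j%:R) by rewrite !mulr_ge0 ?(ltW j0)//; lra.
lra.
Qed.

End staged_averages.

(** * The continuous map from sequences of naturals to points *)

Section reduction.
Context {R : realType} {X : completeMetricType R} (T : X -> X) (phi : X -> R).
Variables (M lo hi : R) (mu nu : probability (borelType X) R).
Hypotheses (cT : continuous T) (cphi : continuous phi).
Hypothesis hT : strong_approx_product_structure T.
Hypothesis phiM : forall x, `|phi x| <= M.
Hypotheses (lo_ge : - M <= lo) (hi_le : hi <= M).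
Hypotheses (mu_inv : invariant_measures T mu) (nu_inv : invariant_measures T nu).
Hypothesis mu_lo : (\int[mu]_x (phi x)%:E = lo%:E)%E.
Hypothesis nu_hi : (\int[nu]_x (phi x)%:E = hi%:E)%E.

(** The segment of high average is a segment of low average for [- phi] under [nu]; the smaller of
    the two scales serves both. *)
Lemma exists_robust_pair (tau : R) : 0 < tau ->
  exists2 d0, 0 < d0 & forall d m, d <= d0 -> (0 < m)%N -> exists x : bool -> X,
    [/\ orbit_sum T phi (x true) m <= m%:R * (lo + tau),
        m%:R * (hi - tau) <= orbit_sum T phi (x false) m &
        forall b, \sum_(j < m) \1_(oscillation_set phi tau d) (iter j T (x b)) <=
          m%:R * tau].
Proof.
move=> tau0.
have [d1 d10 d1P] := exists_robust_orbit cT mu_inv cphi cphi phiM mu_lo tau0.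
have cN : continuous (fun x => - phi x) by move=> x; apply: cvgN; exact: cphi.
have NM x : `|- phi x| <= M by rewrite normrN.
have nuN : (\int[nu]_x (- phi x)%:E = (- hi)%:E)%E.
  have int_phi : nu.-integrable [set: borelType X] (EFin \o phi).
    by apply: bounded_integrable phiM; exact: continuous_measurable_borel.
  rewrite (_ : (fun x => (- phi x)%:E) = fun x : borelType X => ((-1)%:E * (phi x)%:E)%E).
    by rewrite integralZl//= nu_hi -EFinM mulN1r.
  by apply/funext => x; rewrite -EFinM mulN1r.
have [d2 d20 d2P] := exists_robust_orbit cT nu_inv cphi cN NM nuN tau0.
exists (Num.min d1 d2); first by rewrite lt_min d10.
move=> d m; rewrite le_min => /andP[dd1 dd2] m0.
have [x1 [x1_sum x1_osc]] := d1P d m dd1 m0.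
have [x2 [x2_sum x2_osc]] := d2P d m dd2 m0.
exists (fun b => if b then x1 else x2); split=> //; last by case.
by move: x2_sum; rewrite sumrN -/(orbit_sum T phi x2 m) !mulrBr mulrDr mulrN; lra.
Qed.

(** The order of choices matters: the measures give [d k], then [e k] is chosen, and the product
    structure gives [N k], which fixes the block length. None of these depends on [y], [n] or [B],
    so a stage can be made as long as desired. *)
Lemma exists_stages : exists (e : nat -> R) (m : nat -> nat),
  [/\ forall k, 0 < e k, forall k, 2 * e k.+1 <= e k, forall k, e k <= k.+1%:R^-1,
      forall k, (0 < m k)%N &
  forall (k : nat) (t : R) (y : X) (n B : nat), lo <= t <= hi -> (m k <= n)%N ->
  exists y' n', [/\ (B <= n')%N,
    forall j, (j < n)%N -> mdist (iter j T y) (iter j T y') < e k &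
    forall z, (forall j, (j < n')%N -> mdist (iter j T y') (iter j T z) <= e k) ->
      forall i, (n <= i <= n')%N ->
      `|(orbit_sum T phi z i - i%:R * t) - (orbit_sum T phi z n - n%:R * t)| <=
        (6 * M + 2) * ((m k)%:R + k.+1%:R^-1 * (i%:R - n%:R))]].
Proof.
pose tau k : R := k.+1%:R^-1.
have tau0 k : 0 < tau k by rewrite invr_gt0.
have /choice[d dP] : forall k, exists d0, 0 < d0 /\ forall d m,
    d <= d0 -> (0 < m)%N -> exists x : bool -> X,
    [/\ orbit_sum T phi (x true) m <= m%:R * (lo + tau k),
        m%:R * (hi - tau k) <= orbit_sum T phi (x false) m &
        forall b, \sum_(j < m) \1_(oscillation_set phi (tau k) d) (iter j T (x b)) <=
          m%:R * tau k].
  by move=> k; have [d0 d00 d0P] := exists_robust_pair (tau0 k); exists d0.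
(* Three requirements: compatibility with the oscillation scale [d k], convergence to zero, and
   halving, so that all later perturbations together stay below the scale of the current stage. *)
pose e := fix e k : R := Num.min (Num.min (d k / 2) (tau k))
  (if k is k'.+1 then e k' / 2 else 1).
have eE k : e k = Num.min (Num.min (d k / 2) (tau k))
  (if k is k'.+1 then e k' / 2 else 1) by case: k.
have e0 k : 0 < e k.
  have d_gt0 i : 0 < d i by case: (dP i).
  have d2 i : 0 < d i / 2 by exact: divr_gt0.
  elim: k => [|k IHk]; rewrite eE !lt_min tau0 d2//=.
  exact: divr_gt0.
have ed k : e k <= d k / 2 by rewrite eE !ge_min lexx.
have et k : e k <= tau k by rewrite eE !ge_min lexx orbT.
have eS k : e k.+1 <= e k / 2 by rewrite eE !ge_min lexx !orbT.
have /choice[N NP] : forall k, exists N : nat, forall xi : seq (X * nat),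
    specification xi -> (forall p, p \in xi -> (N <= p.2)%N) ->
    exists y : X, approx_traces T (e k) (tau k) (tau k) xi y.
  by move=> k; exact: hT.
exists e, (fun k => maxn 1 (N k)); split=> // [k|k|].
- by have := eS k; lra.
- by rewrite leq_max.
move=> k t y n B /andP[lot thi]; rewrite geq_max => /andP[n0 Nn].
have m0 : (0 < maxn 1 (N k))%N by rewrite leq_max.
have [|x [x_lo x_hi x_osc]] := (dP k).2 (2 * e k) (maxn 1 (N k)) _ m0.
  by have := ed k; lra.
have mR : 0 < (maxn 1 (N k))%:R :> R by rewrite ltr0n.
have tau1 : tau k <= 1 by rewrite invf_le1// ler1n.
have tM : `|t| <= M.
  by rewrite ler_norml (le_trans lo_ge lot) (le_trans thi hi_le).
have [||y' [n' [nn' yy' zP]]] := @stage R X T phi M phiM (e k) (tau k) (2 * e k) t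
  (N k) n (maxn 1 (N k)) B y x (NP k) (tau0 k) tau1 (lexx _) tM n0 m0 Nn
  (leq_maxr _ _) _ _ x_osc.
- by rewrite (le_trans x_lo)// ler_pM2l// lerD2r.
- by rewrite (le_trans _ x_hi)// ler_pM2l// lerD2r.
exists y', n'; split=> //.
by rewrite (leq_trans _ nn')// (leq_trans _ (leq_addl _ _))// leq_pmulr.
Qed.

(** The point [f a] is the limit of the stage points. The first [k] entries of [a] determine the
    first [k] stages, which gives continuity. *)
Lemma exists_steered_orbits (tgt : (nat -> nat) -> nat -> R) :
    (forall a k, lo <= tgt a k <= hi) ->
    (forall a b k, agree k.+1 a b -> tgt b k = tgt a k) ->
  exists f : (nat -> nat) -> X,
    (forall a (O : set X), open O -> O (f a) ->
       exists k, forall b, agree k a b -> O (f b)) /\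
    forall a L, birkhoff_avg T phi k (f a) @[k --> \oo] --> L <->
      forall eps, 0 < eps -> exists K, forall k, (K <= k)%N -> `|tgt a k - L| <= eps.
Proof.
move=> tgt_itv tgt_prefix.
have [e [m [e0 eS eV m0 step]]] := exists_stages.
have /choice[next nextP] : forall p : nat * R * (X * nat), exists q : X * nat,
    lo <= p.1.2 <= hi -> (m p.1.1 <= p.2.2)%N ->
    [/\ (p.1.1.+2 * m p.1.1.+1 + p.1.1.+1 * p.2.2 <= q.2)%N,
      forall j, (j < p.2.2)%N -> mdist (iter j T p.2.1) (iter j T q.1) < e p.1.1 &
      forall z, (forall j, (j < q.2)%N ->
          mdist (iter j T q.1) (iter j T z) <= e p.1.1) ->
        forall i, (p.2.2 <= i <= q.2)%N ->
        `|(orbit_sum T phi z i - i%:R * p.1.2) -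
          (orbit_sum T phi z p.2.2 - p.2.2%:R * p.1.2)| <=
        (6 * M + 2) * ((m p.1.1)%:R + p.1.1.+1%:R^-1 * (i%:R - p.2.2%:R))].
  case=> [[k t] [y n]] /=.
  have [[tI mn]|nP] := pselect (lo <= t <= hi /\ (m k <= n)%N); last first.
    by exists (y, n) => tI mn; case: nP.
  (* This lower bound on the new length makes it dominate both the next block length and the present
     length, as the passage to limits requires. *)
  have [y' [n' []]] := step k t y n (k.+2 * m k.+1 + k.+1 * n)%N tI mn.
  by exists (y', n').
pose st a := fix st k : X * nat :=
  if k is k'.+1 then next (k', tgt a k', st k') else (point, m 0%N).
have st_nm a k : (k.+1 * m k <= (st a k).2)%N.
  elim: k => [|k IHk] /=; first by rewrite mul1n.
  have [||le_n _ _] := nextP (k, tgt a k, st a k) => //=; last first.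
    by rewrite (leq_trans _ le_n)//= leq_addr.
  by rewrite (leq_trans _ IHk)// leq_pmull.
have m_st a k : (m k <= (st a k).2)%N by rewrite (leq_trans _ (st_nm a k))// leq_pmull.
have stS a k := nextP (k, tgt a k, st a k) (tgt_itv a k) (m_st a k).
have st_nS a k : (k.+1 * (st a k).2 <= (st a k.+1).2)%N.
  by have [le_n _ _] := stS a k; rewrite (leq_trans _ le_n)//= leq_addl.
have st_mono a : {homo (fun k => (st a k).2) : i j / (i <= j)%N}.
  apply: homo_leq => [//||k]; first exact: leq_trans.
  by rewrite (leq_trans _ (st_nS a k))// leq_pmull.
have st_pos a k : (0 < (st a k).2)%N by rewrite (leq_trans _ (m_st a k)).
(* The bound telescopes: a step costs less than [e p], and [e p <= 2 * e p - 2 * e p.+1]. *)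
have st_near a k p j : (k <= p)%N -> (j < (st a k).2)%N ->
    mdist (iter j T (st a k).1) (iter j T (st a p).1) <= 2 * e k - 2 * e p.
  move=> kp lt_j; elim: p kp => [|p IHp].
    by rewrite leqn0 => /eqP ->; rewrite mdistxx subrr.
  rewrite leq_eqVlt => /predU1P[<-|]; first by rewrite mdistxx subrr.
  rewrite ltnS => kp; have := IHp kp.
  have [_ /(_ j (leq_trans lt_j (st_mono a _ _ kp))) /= + _] := stS a p.
  have := metric_triangle (iter j T (st a k).1) (iter j T (st a p).1)
    (iter j T (st a p.+1).1).
  by have := eS p; rewrite /=; lra.
pose y a k := (st a k).1.
have e_small (r : R) : 0 < r -> exists K, forall p, 2 * e K - 2 * e p < r.
  move=> r0; have [K Kr] := exists_natSinv_lt (divr_gt0 r0 (ltr0n R 2)).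
  by exists K => p; have := le_lt_trans (eV K) Kr; have := e0 p; lra.
have y_cvg a : cvg (y a k @[k --> \oo]).
  apply/cauchy_cvgP/cauchy_exP => eps eps0.
  have [K Keps] := e_small _ eps0.
  exists (y a K); exists K => // p /= Kp; rewrite ballEmdist/=.
  exact: le_lt_trans (st_near a K p 0%N Kp (st_pos a K)) (Keps p).
pose f a := lim (y a k @[k --> \oo]).
have f_near a k j : (j < (st a k).2)%N ->
    mdist (iter j T (st a k).1) (iter j T (f a)) <= 2 * e k.
  move=> lt_j; apply/ler_addgt0Pr => eps eps0.
  have : iter j T (y a k) @[k --> \oo] --> iter j T (f a).
    by apply: (cvg_comp (y a) (iter j T) (y_cvg a)); exact: iter_continuous.
  move=> /metricType_numDomainType.cvgrPdist_lt/(_ eps eps0)[K _ KP].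
  have := KP (maxn k K) (leq_maxr _ _).
  have := st_near a k (maxn k K) j (leq_maxl _ _) lt_j.
  have := metric_triangle (iter j T (st a k).1) (iter j T (y a (maxn k K)))
    (iter j T (f a)).
  by rewrite (metric_sym (iter j T (f a))) /y/=; have := e0 (maxn k K); lra.
exists f; split=> [a O oO Oa|a L].
  have /metricType_numDomainType.nbhs_mdistP[eps /= eps0 epsO] : nbhs (f a) O.
    exact: open_nbhs_nbhs.
  (* Both [f a] and [f b] lie within [2 * e k] of a common stage point, hence the factor 4. *)
  have [k keps] := exists_natSinv_lt (divr_gt0 eps0 (ltr0n R 4)).
  have {}keps := le_lt_trans (eV k) keps.
  exists k => b ab; apply: epsO => /=.
  have st_ab : st b k = st a k.
    have : forall i, (i <= k)%N -> st b i = st a i; last by apply.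
    elim=> //= i IHi lt_ik; rewrite IHi ?(ltnW lt_ik)// (tgt_prefix a b)//.
    by move=> l lt_l; apply: ab; rewrite (leq_trans lt_l).
  have := f_near a k 0%N (st_pos a k); have := f_near b k 0%N (st_pos b k).
  rewrite st_ab /= => fb fa.
  have := metric_triangle (f a) (st a k).1 (f b).
  by rewrite (metric_sym (f a) (st a k).1); lra.
have M0 : 0 <= M := le_trans (normr_ge0 _) (phiM point).
have SM k j : `|orbit_sum T phi (f a) j - j%:R * tgt a k| <= 2 * M * j%:R.
  apply: orbit_sum_le => //; have /andP[lot thi] := tgt_itv a k.
  by rewrite ler_norml (le_trans lo_ge lot) (le_trans thi hi_le).
have St k j : ((st a k).2 <= j <= (st a k.+1).2)%N ->
    `|(orbit_sum T phi (f a) j - j%:R * tgt a k) -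
      (orbit_sum T phi (f a) (st a k).2 - (st a k).2%:R * tgt a k)| <=
    (6 * M + 2) * ((m k)%:R + k.+1%:R^-1 * (j%:R - (st a k).2%:R)).
  (* The limit is within [2 * e k.+1] of the point that ends stage [k], and this is at most the
     tolerance [e k]. *)
  have [_ _] := stS a k; apply=> i lt_i.
  by apply: le_trans (f_near a k.+1 i lt_i) (eS k).
have C0 : 0 <= 6 * M + 2 by lra.
split=> [avg_L|tgt_L].
  exact: (cvg_average_target M0 C0 m0 (st_nm a) (st_nS a) SM St avg_L).
exact: (target_cvg_average M0 C0 m0 (st_nm a) (st_nS a) SM St tgt_L).
Qed.

(** The targets converge exactly when [a] diverges, and then only to [alpha]; so a single map
    handles both the level set and the complement of the irregular set. *)
Lemma exists_reduction (alpha beta : R) :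
    lo <= alpha <= hi -> lo <= beta <= hi -> alpha != beta ->
  exists f : (nat -> nat) -> X,
    [/\ forall a (O : set X), open O -> O (f a) ->
         exists k, forall b, agree k a b -> O (f b),
        forall a, level_set T phi alpha (f a) <-> diverges a &
        forall a, (~` irregular_set T phi) (f a) <-> diverges a].
Proof.
move=> /andP[loa ahi] /andP[lob bhi] ab.
pose w (a : nat -> nat) k : R := (a k./2).+1%:R^-1.
(* The targets at odd stages force any limit of the averages to be [alpha]. *)
pose tgt a k := if odd k then alpha else alpha + (beta - alpha) * w a k.
have w01 a k : 0 < w a k <= 1 by rewrite invr_gt0 ltr0n invf_le1// ler1n.
have tgt_itv a k : lo <= tgt a k <= hi.
  rewrite /tgt; case: odd; first by rewrite loa.
  by have /andP[w0 w1] := w01 a k; apply/andP; split; nra.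
have tgt_prefix a b k : agree k.+1 a b -> tgt b k = tgt a k.
  by move=> kab; rewrite /tgt /w kab// ltnS -{2}(half_double k) half_leq// -addnn leq_addr.
have [f [f_cont f_avg]] := exists_steered_orbits tgt_itv tgt_prefix.
have dist0 : 0 < `|beta - alpha| by rewrite normr_gt0 subr_eq0 eq_sym.
have div_tgt a : diverges a -> forall eps, 0 < eps ->
    exists K, forall k, (K <= k)%N -> `|tgt a k - alpha| <= eps.
  move=> a_div eps eps0.
  have [c ceps] := exists_natSinv_lt (divr_gt0 eps0 dist0).
  have [K KP] := a_div c; exists K.*2 => k Kk.
  rewrite /tgt; case: odd; first by rewrite subrr normr0 ltW.
  have /andP[w0 _] := w01 a k.
  rewrite addrAC subrr add0r normrM (gtr0_norm w0) mulrC -ler_pdivlMr//.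
  apply: le_trans (ltW ceps); rewrite lef_pV2 ?posrE// ler_nat ltnS KP//.
  by rewrite -(doubleK K) half_leq.
have tgt_div a L : (forall eps, 0 < eps ->
    exists K, forall k, (K <= k)%N -> `|tgt a k - L| <= eps) -> diverges a.
  move=> tL.
  have L_alpha : L = alpha.
    apply/eqP; rewrite -subr_eq0 -normr_le0; apply/ler_addgt0Pr => eps eps0.
    have [K KP] := tL eps eps0; rewrite add0r distrC.
    have := KP K.*2.+1; rewrite /tgt /= odd_double/=; apply.
    by rewrite leqW// -addnn leq_addr.
  move=> c.
  have c0 : 0 < c.+1%:R^-1 :> R by rewrite invr_gt0.
  (* At even stages the target is at distance [|beta - alpha| / (a i + 1)] from [alpha], so this
     tolerance amounts to [c <= a i]. *)
  have [K KP] := tL _ (mulr_gt0 dist0 c0).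
  exists K => k Kk; have := KP k.*2; rewrite /tgt odd_double L_alpha.
  have /andP[w0 _] := w01 a k.*2.
  rewrite addrAC subrr add0r normrM (gtr0_norm w0) ler_pM2l// /w doubleK.
  rewrite lef_pV2 ?posrE// ler_nat ltnS; apply.
  by rewrite (leq_trans Kk)// -addnn leq_addr.
exists f; split=> // a; split.
- by move=> /f_avg/tgt_div.
- by move=> a_div; apply/f_avg; exact: div_tgt.
- by move=> /contrapT/f_avg/tgt_div.
- move=> a_div irr; apply: irr.
  by have := proj2 (f_avg a alpha) (div_tgt a a_div); exact: cvgP.
Qed.

End reduction.

Theorem theorem31 (R : realType) (X : completeMetricType R) (T : X -> X)
    (sepX : separable X) (cT : continuous T)
    (hT : strong_approx_product_structure T)
    (phi : X -> R) (cphi : continuous phi) (bphi : bounded_fun phi) (alpha : R)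
    (hV : measures_with_integral T phi alpha !=set0)
    (hU : invariant_measures T `\` measures_with_integral T phi alpha !=set0) :
  Pi0_3_complete (level_set T phi alpha) /\
  Sigma0_3_complete (irregular_set T phi).
Proof.
have [mu [mu_inv mu_alpha]] := hV.
have [nu [nu_inv nu_alpha]] := hU.
have [M0 phiM0] : exists M, forall x, `|phi x| <= M.
  have [M [_ MP]] := bphi; exists (M + 1) => x.
  by apply: (MP (M + 1)) => //; rewrite ltrDl.
have [beta nu_beta] : exists beta, (\int[nu]_x (phi x)%:E = beta%:E)%E.
  have int_phi : nu.-integrable [set: borelType X] (EFin \o phi).
    by apply: bounded_integrable phiM0; exact: continuous_measurable_borel.
  exists (fine (\int[nu]_x (phi x)%:E)%E); apply/esym/fineK.
  exact: integrable_fin_num.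
have ab : alpha != beta by apply/eqP => ab; apply: nu_alpha; rewrite ab.
(* The bound is enlarged so that the interval from [- M] to [M] visibly contains both integrals. *)
pose M := M0 + `|alpha| + `|beta|.
have phiM x : `|phi x| <= M.
  by rewrite /M -addrA (le_trans (phiM0 x))// lerDl addr_ge0.
have M0_ge0 : 0 <= M0 := le_trans (normr_ge0 _) (phiM0 point).
have /andP[aM Ma] : - M <= alpha <= M by rewrite -ler_norml /M addrAC lerDr addr_ge0.
have /andP[bM Mb] : - M <= beta <= M by rewrite -ler_norml /M lerDr addr_ge0.
have [f [f_cont f_level f_irr]] : exists f : (nat -> nat) -> X,
    [/\ forall a (O : set X), open O -> O (f a) ->
         exists k, forall b, agree k a b -> O (f b),
        forall a, level_set T phi alpha (f a) <-> diverges a &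
        forall a, (~` irregular_set T phi) (f a) <-> diverges a].
  (* The measure with the smaller integral supplies the low blocks; [alpha] may be either
     endpoint. *)
  have [le_ab|/ltW le_ba] := leP alpha beta.
    by apply: (exists_reduction cT cphi hT phiM aM Mb mu_inv nu_inv mu_alpha nu_beta _ _ ab);
      rewrite lexx le_ab.
  by apply: (exists_reduction cT cphi hT phiM bM Ma nu_inv mu_inv nu_beta mu_alpha _ _ ab);
    rewrite lexx le_ba.
split; split.
- exact: Pi0_3_level_set.
- by move=> /(Sigma0_3_reduction f_cont).
- exact: Sigma0_3_irregular_set.
(* [Pi0 3] of the irregular set is by definition [Sigma0 3] of its complement, which [f] also
   reduces to divergence. *)
- by move=> /(Sigma0_3_reduction f_cont).
Qed.
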